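(* Let $X$ be an infinite dimensional, separable $F$-space and $T\in\mathcal{L}(X)$. Then $(X,T)$ is mixing if and only if there exist two dense subsets $D_1,D_2$ of $X$ and two sequences of mappings $I_n:D_1\to X$, $S_n:D_2\to X$ ($n\in\mathbb{N}$) such that the following conditions hold: (i) $\lim_n (I_n(x),T^n(I_n(x)))=(x,0)$ for every $x\in D_1$; (ii) $\lim_n (S_n(y),T^n(S_n(y)))=(0,y)$ for every $y\in D_2$.
   Context: $\mathcal{L}(X)$ is the set of all bounded (i.e. continuous) linear operators on $X$. The mappings $I_n,S_n$ are not assumed linear or continuous, and limits are taken in $X\times X$ as $n\to\infty$. $(X,T)$ is mixing if for every pair of non-empty open sets $U,V\subset X$ there exists $N\in\mathbb{N}$ such that $T^n(U)\cap V\neq\emptyset$ for all $n\geq N$. *)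

(* Defs.v *)
From HB Require Import structures.
From mathcomp Require Import all_boot all_order all_algebra.
From mathcomp Require Import all_classical all_reals all_analysis.
From mathcomp Require Import complex.

Set Implicit Arguments.
Unset Strict Implicit.
Unset Printing Implicit Defensive.

Import Order.TTheory GRing.Theory Num.Theory.
Import numFieldTopology.Exports numFieldNormedType.Exports.

Local Open Scope classical_set_scope.
Local Open Scope ring_scope.

(* The ground field of an F-space is the field of real or of complex numbers. *)
Variant scalars := RealScalars | ComplexScalars.

Definition scalar_field (R : realType) (k : scalars) : numFieldType :=
  match k with
  | RealScalars => R
  | ComplexScalars => R[i]
  end.

Definition is_metric (R : realType) (X : Type) (d : X -> X -> R) :=
  [/\ forall x y, 0 <= d x y,
      forall x y, d x y = 0 <-> x = y,
      forall x y, d x y = d y x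
    & forall x y z, d x z <= d x y + d y z].

Definition induces_topology (R : realType) (X : topologicalType)
    (d : X -> X -> R) :=
  forall (x : X) (A : set X),
    nbhs x A <-> exists2 e : R, 0 < e & [set y | d x y < e] `<=` A.

Definition complete_metric (R : realType) (X : Type) (d : X -> X -> R) :=
  forall u : nat -> X,
    (forall e : R, 0 < e -> exists N : nat, forall m n : nat,
       (N <= m)%N -> (N <= n)%N -> d (u m) (u n) < e) ->
    exists l : X, forall e : R, 0 < e -> exists N : nat, forall n : nat,
      (N <= n)%N -> d (u n) l < e.

Definition translation_invariant (R : realType) (X : zmodType)
    (d : X -> X -> R) :=
  forall x y z : X, d (x + z) (y + z) = d x y.

(* A topological vector space is an F-space when its topology is induced by a
   complete translation-invariant metric; local convexity is not required. The
   metric takes its values in R also when K is the field of complex numbers. *)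
Definition is_fspace (R : realType) (K : numFieldType)
    (X : topologicalLmodType K) :=
  exists d : X -> X -> R,
    [/\ is_metric d, induces_topology d, complete_metric d
      & translation_invariant d].

Definition infinite_dimensional (K : numFieldType) (X : lmodType K) :=
  ~ exists (n : nat) (b : 'I_n -> X),
      forall x : X, exists a : 'I_n -> K, x = \sum_(i < n) a i *: b i.

Definition separable (X : topologicalType) :=
  exists2 D : set X, countable D & dense D.

Definition mixing (X : topologicalType) (T : X -> X) :=
  forall U V : set X, open U -> U !=set0 -> open V -> V !=set0 ->
  exists N : nat, forall n : nat, (N <= n)%N ->
    (iter n T @` U) `&` V !=set0.

(* Main.v *)
Require Import Defs.
From HB Require Import structures.
From mathcomp Require Import all_boot all_order all_algebra.
From mathcomp Require Import all_classical all_reals all_analysis.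
From mathcomp Require Import complex.
From mathcomp Require Import ring.

Set Implicit Arguments.
Unset Strict Implicit.
Unset Printing Implicit Defensive.

Import Order.TTheory GRing.Theory Num.Theory.
Import numFieldTopology.Exports numFieldNormedType.Exports.

Local Open Scope classical_set_scope.
Local Open Scope ring_scope.

(** Mixing amounts to approximability: every pair (x, y) is the limit of some (z_n, T^n z_n). A
    mixing map has this property because the topology is metric, so a near-best z_n can be picked
    for each n ([mixing_orbit_approx]); the pairs (x, 0) and (0, y) then give (i) and (ii).
    Conversely, linearity lets the two special kinds of pair be added: I_n x + S_n y tends to x
    while its image under T^n tends to y, and density places x in [U] and y in [V]. *)

Lemma iterD (K : numFieldType) (X : lmodType K) (T : {linear X -> X})
    (n : nat) (x y : X) :
  iter n T (x + y) = iter n T x + iter n T y.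
Proof. by elim: n => //= n ->; rewrite linearD. Qed.

(* z n is chosen to minimise d x z + d y (T^n z) up to 1 / (n + 1); mixing makes
   the infimum tend to 0. *)
Lemma mixing_orbit_approx (R : realType) (X : topologicalType)
    (d : X -> X -> R) (T : X -> X) (x y : X) :
  is_metric d -> induces_topology d -> mixing T ->
  exists z : nat -> X, (z n, iter n T (z n)) @[n --> \oo] --> (x, y).
Proof.
move=> [d_ge0 _ _ _] d_top T_mixing.
pose f n z := d x z + d y (iter n T z).
have f_ge0 n z : 0 <= f n z by rewrite addr_ge0.
have near_min n : exists z, forall w, f n z < f n w + n.+1%:R^-1.
  have f_inf : has_inf (range (f n)).
    by split; [exists (f n x), x | exists 0 => _ [w _ <-]].
  have /(inf_adherent)/(_ f_inf)[_ [z _ <-] z_lt] : (0 : R) < n.+1%:R^-1.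
    by rewrite invr_gt0.
  exists z => w; apply: (lt_le_trans z_lt); rewrite lerD2r.
  by apply: ge_inf; [case: f_inf | exists w].
have [z z_min] := choice near_min.
have f_small (e : R) : 0 < e -> \forall n \near \oo, f n (z n) < e.
  move=> e_gt0.
  (* Two thirds bound the distances achieved by a competitor [w] that mixing supplies; the last
     absorbs the slack 1 / (n + 1) of the near-minimiser. *)
  have e3_gt0 : 0 < e / 3 by rewrite divr_gt0.
  have ball_nbhs u : nbhs u [set v | d u v < e / 3] by apply/d_top; exists (e / 3).
  (* Mixing speaks of open sets, while [d_top] gives balls only as neighbourhoods of their centres;
     hence the interiors. *)
  have ballI u : [set v | d u v < e / 3]° !=set0.
    by exists u; exact: ball_nbhs.
  have [N TN] := T_mixing _ _ (@open_interior _ _) (ballI x)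
                              (@open_interior _ _) (ballI y).
  near=> n.
  have [|_ [[w /interior_subset /= xw <-] /interior_subset /= yw]] := TN n.
    by near: n; exact: nbhs_infty_ge.
  have n_large : n.+1%:R^-1 < e / 3.
    by near: n; exact: near_infty_natSinv_lt (PosNum e3_gt0).
  apply: (lt_trans (z_min n w)); have -> : e = e / 3 + e / 3 + e / 3 by field.
  by rewrite !ltrD.
(* Each of the two distances is at most their sum [f n (z n)]. *)
exists z; apply: cvg_pair => /= A /d_top[e e_gt0 eA].
  apply: filterS (f_small e e_gt0) => n fn; apply: eA => /=.
  by apply: le_lt_trans fn; rewrite lerDl.
apply: filterS (f_small e e_gt0) => n fn; apply: eA => /=.
by apply: le_lt_trans fn; rewrite lerDr.
Unshelve. all: by end_near. Qed.

Theorem corollary3p7 (R : realType) (k : scalars)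
    (X : topologicalLmodType (scalar_field R k)) (X_fspace : is_fspace R X)
    (X_infdim : infinite_dimensional X) (X_separable : separable X)
    (T : {linear X -> X}) (T_continuous : continuous T) :
  mixing T <->
  exists (D1 D2 : set X) (I : nat -> D1 -> X) (S : nat -> D2 -> X),
    [/\ dense D1, dense D2,
        forall x : D1,
          (I n x, iter n T (I n x)) @[n --> \oo] --> ((\val x, 0) : X * X)
      & forall y : D2,
          (S n y, iter n T (S n y)) @[n --> \oo] --> ((0, \val y) : X * X)].
Proof.
split=> [T_mixing|[D1 [D2 [I [S [D1_dense D2_dense I_cvg S_cvg]]]]]].
  have [d [d_metric d_top _ _]] := X_fspace.
  have approx x y := mixing_orbit_approx x y d_metric d_top T_mixing.
  have [I I_cvg] := choice (approx^~ 0).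
  have [S S_cvg] := choice (approx 0).
  (* Approximation works at every point, so the whole space serves as both dense sets. *)
  exists setT, setT, (fun n x => I (\val x) n), (fun n y => S (\val y) n).
  have denseT : dense [set: X] by move=> U ? _; rewrite setIT.
  by split=> [||x|y]; [exact: denseT | exact: denseT | exact: I_cvg | exact: S_cvg].
move=> U V U_open U_neq0 V_open V_neq0.
have [x [Ux D1x]] := D1_dense U U_neq0 U_open.
have [y [Vy D2y]] := D2_dense V V_neq0 V_open.
pose x1 : D1 := exist _ x (mem_set D1x).
pose y2 : D2 := exist _ y (mem_set D2y).
(* Perturbing I_n x by S_n y --> 0 shifts T^n (I_n x) --> 0 to T^n z_n --> y. *)
pose z n := I n x1 + S n y2.
have cvg_add (u v : nat -> X) a b : u n @[n --> \oo] --> a ->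
    v n @[n --> \oo] --> b -> u n + v n @[n --> \oo] --> a + b.
  by move=> ua vb; apply: (cvg_comp2 ua vb); exact: (@add_continuous X (a, b)).
have Ix := I_cvg x1; have Sy := S_cvg y2.
(* The limits arise as x + 0 here and, through additivity of T^n, as 0 + y below. *)
have z_cvg : z n @[n --> \oo] --> x.
  rewrite -[x]addr0.
  by apply: cvg_add; [exact: cvg_comp Ix cvg_fst | exact: cvg_comp Sy cvg_fst].
have Tz_cvg : iter n T (z n) @[n --> \oo] --> y.
  under eq_fun do rewrite iterD.
  rewrite -[y]add0r.
  by apply: cvg_add; [exact: cvg_comp Ix cvg_snd | exact: cvg_comp Sy cvg_snd].
have [M _ z_U] := z_cvg U (open_nbhs_nbhs (conj U_open Ux)).
have [N _ Tz_V] := Tz_cvg V (open_nbhs_nbhs (conj V_open Vy)).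
exists (maxn M N) => n; rewrite geq_max => /andP[Mn Nn].
by exists (iter n T (z n)); split; [exists (z n) => //; exact: z_U | exact: Tz_V].
Qed.
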